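(* Let $f,g:\mathbb{R}^n\to(-\infty,+\infty]$ be proper, lower semicontinuous and prox-bounded with thresholds $\lambda_f,\lambda_g>0$, let $0<\mu<\bar\lambda=\min\{\lambda_f,\lambda_g\}$, $\alpha\in[0,1]$, and let $\varphi^{\alpha}_{\mu}=-e_{\mu}(-\alpha e_{\mu}f-(1-\alpha)e_{\mu}g)$. Then: (a) $$\inf\Big(\varphi^{\alpha}_{\mu}+\tfrac{1}{2\mu}\|\cdot\|^2\Big)=\alpha\inf\Big(f+\tfrac{1}{2\mu}\|\cdot\|^2\Big)+(1-\alpha)\inf\Big(g+\tfrac{1}{2\mu}\|\cdot\|^2\Big);$$ (b) $$\operatorname{argmin}\Big(\varphi^{\alpha}_{\mu}+\tfrac{1}{2\mu}\|\cdot\|^2\Big)=\alpha\operatorname{conv}\Big[\operatorname{argmin}\Big(f+\tfrac{1}{2\mu}\|\cdot\|^2\Big)\Big]+(1-\alpha)\operatorname{conv}\Big[\operatorname{argmin}\Big(g+\tfrac{1}{2\mu}\|\cdot\|^2\Big)\Big]\neq\varnothing.$$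
   Context: $\|\cdot\|$ is the Euclidean norm; $\inf$ and $\operatorname{argmin}$ of a function are over $\mathbb{R}^n$; $\operatorname{conv}$ is the convex hull of a set and sums of sets are Minkowski sums. For a proper function $f$ and $\mu>0$, $e_{\mu}f(x)=\inf_{w}\{f(w)+\frac{1}{2\mu}\|w-x\|^2\}$. $f$ is prox-bounded if there exist $\lambda>0$ and $x$ with $e_{\lambda}f(x)>-\infty$; the supremum of all such $\lambda$ is its threshold $\lambda_f\in(0,+\infty]$. *)

(* Defs.v *)
From HB Require Import structures.
From mathcomp Require Import all_boot all_order all_algebra.
From mathcomp Require Import all_classical all_reals all_analysis.

Set Implicit Arguments.
Unset Strict Implicit.
Unset Printing Implicit Defensive.

Import Order.TTheory GRing.Theory Num.Theory.
Import numFieldNormedType.Exports.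

Local Open Scope classical_set_scope.
Local Open Scope ring_scope.
Local Open Scope ereal_scope.

(* The library norm [`|x|] on 'rV[R]_n is the max norm. *)
Definition enorm (R : realType) (n : nat) (x : 'rV[R]_n) : R :=
  Num.sqrt (\sum_(i < n) (x ord0 i) ^+ 2)%R.

Definition proper_fun (R : realType) (n : nat) (f : 'rV[R]_n -> \bar R) : Prop :=
  (forall x, -oo < f x) /\ (exists x, f x < +oo).

Definition moreau (R : realType) (n : nat) (mu : R) (f : 'rV[R]_n -> \bar R) :
    'rV[R]_n -> \bar R :=
  fun x => ereal_inf
    (range (fun w => f w + ((2 * mu)^-1 * enorm (w - x) ^+ 2)%R%:E)).

Definition prox_bounded (R : realType) (n : nat) (f : 'rV[R]_n -> \bar R) :
    Prop :=
  exists2 lambda : R, (0 < lambda)%R & exists x, -oo < moreau lambda f x.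

Definition prox_threshold (R : realType) (n : nat) (f : 'rV[R]_n -> \bar R) :
    \bar R :=
  ereal_sup [set lambda%:E | lambda in
    [set lambda : R | (0 < lambda)%R /\ exists x, -oo < moreau lambda f x]].

(* phi^alpha_mu; where the theorem uses it both envelopes are finite, so the
   library convention for (+oo) + (-oo) plays no role. *)
Definition prox_avg (R : realType) (n : nat) (mu alpha : R)
    (f g : 'rV[R]_n -> \bar R) : 'rV[R]_n -> \bar R :=
  fun x => - moreau mu
    (fun w => - (alpha%:E * moreau mu f w) - (1 - alpha)%:E * moreau mu g w) x.

Definition add_quad (R : realType) (n : nat) (mu : R)
    (f : 'rV[R]_n -> \bar R) : 'rV[R]_n -> \bar R :=
  fun x => f x + ((2 * mu)^-1 * enorm x ^+ 2)%R%:E.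

Definition inf_fun (R : realType) (n : nat) (f : 'rV[R]_n -> \bar R) : \bar R :=
  ereal_inf (range f).

Definition argmin (R : realType) (n : nat) (f : 'rV[R]_n -> \bar R) :
    set 'rV[R]_n :=
  [set x | f x = inf_fun f].

Definition conv_hull (R : realType) (n : nat) (A : set 'rV[R]_n) :
    set 'rV[R]_n :=
  smallest (@convex_set R 'rV[R]_n) A.

Definition scale_set (R : realType) (n : nat) (c : R) (A : set 'rV[R]_n) :
    set 'rV[R]_n :=
  [set (c *: x)%R | x in A].

Definition minkowski_sum (R : realType) (n : nat) (A B : set 'rV[R]_n) :
    set 'rV[R]_n :=
  [set (x + y)%R | x in A & y in B].

(* Main.v *)
Require Import Defs.
From HB Require Import structures.
From mathcomp Require Import all_boot all_order all_algebra.
From mathcomp Require Import all_classical all_reals all_analysis.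
From mathcomp Require Import ring lra.

(* Put F = f + |.|^2/(2 mu), G = g + |.|^2/(2 mu). Expanding the squares,
   phi + |.|^2/(2 mu) is the conjugate of h = alpha F^* + (1 - alpha) G^*, with
   F^* and G^* finite everywhere because mu is below both thresholds. Hence its
   infimum is -h(0) and its minimizers are the subgradients of h at 0. Points of
   alpha conv(argmin F) + (1 - alpha) conv(argmin G) are such subgradients by
   Fenchel's inequality. Conversely, this set is convex and, by Carathéodory,
   the convex hull of a compact set is compact, so a point x outside is strictly
   separated by some v from alpha argmin F + (1 - alpha) argmin G; evaluating h
   at a small multiple of v then contradicts that x is a subgradient. *)

Set Implicit Arguments.
Unset Strict Implicit.
Unset Printing Implicit Defensive.

Import Order.TTheory GRing.Theory Num.Theory.
Import numFieldNormedType.Exports.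

Local Open Scope classical_set_scope.
Local Open Scope ring_scope.

(** * Convex sets, hulls and Minkowski sums *)

Lemma convex_setP (R : realType) (n : nat) (A : set 'rV[R]_n) :
  @convex_set R 'rV[R]_n A <->
  forall x y t, A x -> A y -> 0 <= t -> t <= 1 -> A (t *: x + (1 - t) *: y).
Proof.
split=> cA x y t.
  move=> Ax Ay t0 t1.
  by have := cA x y (Itv01 t0 t1) (mem_set Ax) (mem_set Ay); rewrite inE.
by move=> /set_mem Ax /set_mem Ay; apply/mem_set; exact: cA.
Qed.

Lemma sub_conv_hull (R : realType) (n : nat) (A : set 'rV[R]_n) :
  A `<=` conv_hull A.
Proof. exact: sub_gen_smallest. Qed.

Lemma convex_conv_hull (R : realType) (n : nat) (A : set 'rV[R]_n) :
  @convex_set R 'rV[R]_n (conv_hull A).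
Proof.
apply/convex_setP => x y t hx hy t0 t1 B [cB AB].
by move/convex_setP : (cB); apply => //; [exact: hx | exact: hy].
Qed.

Lemma convex_minkowski_sum_scale (R : realType) (n : nat) (a b : R)
    (A B : set 'rV[R]_n) :
  @convex_set R 'rV[R]_n A -> @convex_set R 'rV[R]_n B ->
  @convex_set R 'rV[R]_n (minkowski_sum (scale_set a A) (scale_set b B)).
Proof.
move=> /convex_setP cA /convex_setP cB; apply/convex_setP => x y t.
move=> [_ [u Au <-] [_ [v Bv <-] <-]] [_ [u' Au' <-] [_ [v' Bv' <-] <-]] t0 t1.
exists (a *: (t *: u + (1 - t) *: u')).
  by exists (t *: u + (1 - t) *: u') => //; apply: cA.
exists (b *: (t *: v + (1 - t) *: v')).
  by exists (t *: v + (1 - t) *: v') => //; apply: cB.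
rewrite !scalerDr !scalerA addrACA; congr (_ *: _ + _ *: _ + (_ *: _ + _ *: _)); ring.
Qed.

(** * Convex combinations of bounded length and Carathéodory's theorem *)

Definition convex_comb (R : realType) (n k : nat) (D : set 'rV[R]_n) :
    set 'rV[R]_n :=
  [set x | exists (l : 'I_k -> R) (a : 'I_k -> 'rV[R]_n),
    [/\ forall i, 0 <= l i, \sum_i l i = 1, forall i, D (a i)
      & x = \sum_i l i *: a i]].

Lemma sub_convex_comb (R : realType) (n k : nat) (D : set 'rV[R]_n) :
  D `<=` convex_comb k.+1 D.
Proof.
move=> x Dx; exists (fun i => (i == ord0)%:R), (fun=> x).
have s1 : \sum_(i < k.+1) (i == ord0)%:R = 1 :> R.
  by rewrite (bigD1 ord0)//= big1 ?addr0// => i /negbTE ->.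
by split => //; rewrite -scaler_suml s1 scale1r.
Qed.

Lemma convex_comb_sub (R : realType) (n k : nat) (D C : set 'rV[R]_n) :
  @convex_set R 'rV[R]_n C -> D `<=` C -> convex_comb k D `<=` C.
Proof.
move=> cC DC; elim: k => [|k IH] x [l [a [l0 l1 Da ->]]].
  by move: l1; rewrite big_ord0 => /eqP; rewrite eq_sym oner_eq0.
move: l1; rewrite !big_ord_recl => l1.
(* The induction rescales the remaining weights by [1 - l ord0], so the case where this factor
   vanishes is treated apart. *)
have [L1|L1] := eqVneq (l ord0) 1.
  have s0 : \sum_(i < k) l (lift ord0 i) = 0 by move: l1; rewrite L1; lra.
  have z := psumr_eq0P (fun i _ => l0 (lift ord0 i)) s0.
  rewrite big1 => [|i _]; last by rewrite z// scale0r.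
  by rewrite addr0 L1 scale1r; exact: DC.
set s := 1 - l ord0.
have sE : s = \sum_(i < k) l (lift ord0 i) by rewrite /s -l1; ring.
have s0 : 0 < s.
  by rewrite lt_neqAle eq_sym {1}/s subr_eq0 eq_sym L1 sE sumr_ge0.
suff H : C (\sum_(i < k) (s^-1 * l (lift ord0 i)) *: a (lift ord0 i)).
  have -> : \sum_(i < k) l (lift ord0 i) *: a (lift ord0 i) =
    (1 - l ord0) *: \sum_(i < k) (s^-1 * l (lift ord0 i)) *: a (lift ord0 i).
    rewrite scaler_sumr; apply: eq_bigr => i _.
    by rewrite scalerA mulrA divff ?mul1r// gt_eqF.
  move/convex_setP : cC; apply => //; first exact: DC.
  by rewrite -subr_ge0 ltW.
apply: IH; exists (fun i => s^-1 * l (lift ord0 i)), (fun i => a (lift ord0 i)).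
split=> // [i|]; first by rewrite mulr_ge0// invr_ge0 ltW.
by rewrite -mulr_sumr -sE mulVf// gt_eqF.
Qed.

(* Carathéodory: k.+1 > n.+1 points lifted to height 1 are linearly dependent;
   moving the weights along a dependency until the first one vanishes drops a
   point. *)
Lemma convex_comb_drop (R : realType) (n k : nat) (D : set 'rV[R]_n) :
  (n < k)%N -> convex_comb k.+1 D `<=` convex_comb k D.
Proof.
move=> nk x [l [a [l0 l1 Da xE]]].
pose M : 'M[R]_(k.+1, n + 1) := row_mx (\matrix_i a i) (const_mx 1).
have : kermx M != 0.
  rewrite kermx_eq0 -row_leq_rank -ltnNge.
  by apply: leq_ltn_trans (rank_leq_col M) _; rewrite addn1.
move=> /rowV0Pn[u /sub_kermxP uM u0].
move: uM; rewrite mul_mx_row -row_mx0 => /eq_row_mx[ua u1].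
have {}ua : \sum_i u ord0 i *: a i = 0.
  apply: etrans ua; rewrite mulmx_sum_row.
  by apply: eq_bigr => i _; rewrite rowK.
have {}u1 : \sum_i u ord0 i = 0.
  move/matrixP/(_ ord0 ord0) : u1; rewrite !mxE; apply: etrans.
  by apply: eq_bigr => i _; rewrite mxE mulr1.
(* The coefficients of the affine dependency sum to 0 without all vanishing, so one of them is
   positive. *)
have [j uj] : exists j, 0 < u ord0 j.
  apply: contrapT => /forallNP npos; move/eqP : u0; apply.
  apply/rowP => i; rewrite mxE.
  have un (h : 'I_k.+1) : 0 <= - u ord0 h.
    by rewrite oppr_ge0 leNgt; apply/negP/npos.
  have := psumr_eq0P (fun h _ => un h) => /(_ predT).
  rewrite sumrN u1 oppr0 => /(_ erefl i isT) /eqP.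
  by rewrite oppr_eq0 => /eqP.
pose i0 := [arg min_(i < j | 0 < u ord0 i) (l i / u ord0 i)]%O.
have [ui0 i0min] : 0 < u ord0 i0 /\
    forall i, 0 < u ord0 i -> l i0 / u ord0 i0 <= l i / u ord0 i.
  by rewrite /i0; case: arg_minP => // i ui mi; split.
(* The largest step that keeps every weight nonnegative; the weight at [i0] is then exactly 0. *)
pose t := l i0 / u ord0 i0.
pose l' i := l i - t * u ord0 i.
have t0 : 0 <= t by rewrite divr_ge0// ltW.
have l'0 i : 0 <= l' i.
  rewrite subr_ge0; have [ui|ui] := ltP 0 (u ord0 i).
    by rewrite -ler_pdivlMr//; exact: i0min.
  by apply: le_trans (l0 i); rewrite mulr_ge0_le0.
have l'i0 : l' i0 = 0 by rewrite /l' /t divfK ?subrr// gt_eqF.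
have l'1 : \sum_i l' i = 1 by rewrite sumrB l1 -mulr_sumr u1 mulr0 subr0.
have l'x : \sum_i l' i *: a i = x.
  under eq_bigr do rewrite scalerBl -scalerA.
  by rewrite sumrB -scaler_sumr ua scaler0 subr0.
exists (fun i => l' (lift i0 i)), (fun i => a (lift i0 i)); split => //.
  by rewrite -l'1 (bigD1_ord i0)//= l'i0 add0r.
by rewrite -l'x (bigD1_ord i0)//= l'i0 scale0r add0r.
Qed.

Lemma caratheodory (R : realType) (n k : nat) (D : set 'rV[R]_n) :
  (n < k)%N -> convex_comb k D `<=` convex_comb n.+1 D.
Proof.
move=> /subnKC <-; elim: (k - n.+1)%N => [|m IH]; first by rewrite addn0.
rewrite addnS; apply: subset_trans IH; apply: convex_comb_drop.
by rewrite addSn ltnS leq_addr.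
Qed.

(** Mixing two combinations of length [n.+1] concatenates them into one of length [n.+1 + n.+1],
    which Carathéodory shortens back. *)
Lemma convex_set_convex_comb (R : realType) (n : nat) (D : set 'rV[R]_n) :
  @convex_set R 'rV[R]_n (convex_comb n.+1 D).
Proof.
apply/convex_setP => x y t [l [a [l0 l1 Da ->]]] [m [b [m0 m1 Db ->]]] t0 t1.
apply: (@caratheodory _ _ (n.+1 + n.+1)); first by rewrite ltn_addr.
pose w (j : 'I_n.+1 + 'I_n.+1) :=
  match j with inl j => t * l j | inr j => (1 - t) * m j end.
pose c (j : 'I_n.+1 + 'I_n.+1) := match j with inl j => a j | inr j => b j end.
exists (w \o @fintype.split _ _), (c \o @fintype.split _ _); split.
- by move=> i /=; case: fintype.split => j /=; rewrite mulr_ge0// subr_ge0.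
- rewrite big_split_ord/=.
  under eq_bigr do rewrite (unsplitK (inl _)).
  under [X in _ + X]eq_bigr do rewrite (unsplitK (inr _)).
  by rewrite -!mulr_sumr l1 m1; ring.
- by move=> i /=; case: fintype.split => j /=.
- rewrite big_split_ord/= !scaler_sumr; congr (_ + _); apply: eq_bigr => i _.
    by rewrite (unsplitK (inl _)) scalerA.
  by rewrite (unsplitK (inr _)) scalerA.
Qed.

(** With the length [k] fixed, the set is the continuous image of a closed part of a product of [k]
    copies of [[0, 1] * D], compact by Tychonoff. *)
Lemma compact_convex_comb (R : realType) (n k : nat) (D : set 'rV[R]_n) :
  compact D -> compact (convex_comb k D).
Proof.
move=> cD.
pose T := prod_topology (fun _ : 'I_k => (R * 'rV[R]_n)%type).
pose K : set T := [set p | forall i, (`[0, 1] `*` D) (p i)].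
have cK : compact K.
  apply: (@tychonoff 'I_k (fun=> (R * 'rV[R]_n)%type) (fun=> `[0, 1] `*` D)).
  by move=> _; apply: compact_setX => //; exact: segment_compact.
have c1 i : continuous (fun p : T => (p i).1).
  move=> p; apply: (@continuous_comp _ _ _ (fun p : T => p i) fst).
    exact: (@proj_continuous 'I_k (fun=> (R * 'rV[R]_n)%type) i).
  exact: cvg_fst.
have c2 i : continuous (fun p : T => (p i).2).
  move=> p; apply: (@continuous_comp _ _ _ (fun p : T => p i) snd).
    exact: (@proj_continuous 'I_k (fun=> (R * 'rV[R]_n)%type) i).
  exact: cvg_snd.
have cs : continuous (fun p : T => \sum_i (p i).1).
  by apply: continuous_big => //; exact: add_continuous.
have cc : continuous (fun p : T => \sum_i (p i).1 *: (p i).2).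
  apply: continuous_big => [|i _ p]; first exact: add_continuous.
  exact: (@continuousZ R 'rV[R]_n T _ _ p (c1 i p) (c2 i p)).
have cK1 : compact (K `&` [set p : T | \sum_i (p i).1 = 1]).
  apply: compact_closedI => //.
  by apply: (preimage_closed _ (@closed_eq _ 1)) => p _; exact: cs.
rewrite (_ : convex_comb k D = (fun p : T => \sum_i (p i).1 *: (p i).2) @`
    (K `&` [set p : T | \sum_i (p i).1 = 1])).
  by apply: continuous_compact => //; exact: continuous_subspaceT.
apply/seteqP; split=> [x [l [a [l0 l1 Da ->]]]|_ [p [Kp p1] <-]].
  exists (fun i => (l i, a i)) => //; split => // i; split => //=.
  rewrite in_itv/= l0/= -l1 (bigD1 i)//= lerDl.
  by rewrite sumr_ge0.
exists (fun i => (p i).1), (fun i => (p i).2); split => // i.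
  by have [/=] := Kp i; rewrite in_itv/= => /andP[].
by have [] := Kp i.
Qed.

(** * The Euclidean inner product and strict separation *)

Definition dot (R : realType) (n : nat) (u v : 'rV[R]_n) : R :=
  \sum_i u ord0 i * v ord0 i.

Lemma dotC (R : realType) (n : nat) (u v : 'rV[R]_n) : dot u v = dot v u.
Proof. by apply: eq_bigr => i _; rewrite mulrC. Qed.

Lemma dotDr (R : realType) (n : nat) (u v w : 'rV[R]_n) :
  dot u (v + w) = dot u v + dot u w.
Proof. by rewrite -big_split; apply: eq_bigr => i _; rewrite mxE mulrDr. Qed.

Lemma dotZr (R : realType) (n : nat) (a : R) (u v : 'rV[R]_n) :
  dot u (a *: v) = a * dot u v.
Proof. by rewrite mulr_sumr; apply: eq_bigr => i _; rewrite mxE mulrCA. Qed.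

Lemma dotNr (R : realType) (n : nat) (u v : 'rV[R]_n) :
  dot u (- v) = - dot u v.
Proof. by rewrite -scaleN1r dotZr mulN1r. Qed.

Lemma dotDl (R : realType) (n : nat) (u v w : 'rV[R]_n) :
  dot (u + v) w = dot u w + dot v w.
Proof. by rewrite !(dotC _ w) dotDr. Qed.

Lemma dotZl (R : realType) (n : nat) (a : R) (u v : 'rV[R]_n) :
  dot (a *: u) v = a * dot u v.
Proof. by rewrite !(dotC _ v) dotZr. Qed.

Lemma dotNl (R : realType) (n : nat) (u v : 'rV[R]_n) :
  dot (- u) v = - dot u v.
Proof. by rewrite !(dotC _ v) dotNr. Qed.

Lemma dot0l (R : realType) (n : nat) (u : 'rV[R]_n) : dot 0 u = 0.
Proof. by rewrite -(scale0r 0) dotZl mul0r. Qed.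

Definition dotE := (dotDl, dotDr, dotNl, dotNr, dotZl, dotZr).

Lemma dot_ge0 (R : realType) (n : nat) (u : 'rV[R]_n) : 0 <= dot u u.
Proof. by apply: sumr_ge0 => i _; rewrite -expr2 sqr_ge0. Qed.

Lemma dot_gt0 (R : realType) (n : nat) (u : 'rV[R]_n) : u != 0 -> 0 < dot u u.
Proof.
move=> u0; rewrite lt_neqAle dot_ge0 andbT eq_sym; apply: contraNneq u0 => uu0.
apply/eqP/rowP => i; rewrite mxE; apply/eqP; rewrite -sqrf_eq0 expr2.
by rewrite (psumr_eq0P _ uu0)// => j _; rewrite -expr2 sqr_ge0.
Qed.

Lemma enorm_sqr (R : realType) (n : nat) (u : 'rV[R]_n) :
  enorm u ^+ 2 = dot u u.
Proof.
by rewrite sqr_sqrtr; [apply: eq_bigr => i _; rewrite expr2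
                      |apply: sumr_ge0 => i _; rewrite sqr_ge0].
Qed.

(** Expand the square of [c *: v - u], which is nonnegative, and divide by [c]. *)
Lemma dot_young (R : realType) (n : nat) (c : R) (u v : 'rV[R]_n) :
  0 < c -> 2 * dot u v <= c * dot v v + c^-1 * dot u u.
Proof.
move=> c0; have := dot_ge0 (c *: v - u); rewrite !dotE (dotC v u) => h.
rewrite -(ler_pM2l c0) mulrDr [c * (c^-1 * _)]mulrA divff ?gt_eqF// mul1r.
by lra.
Qed.

Lemma continuous_dot (R : realType) (n : nat) (f g : 'rV[R]_n -> 'rV[R]_n) :
  continuous f -> continuous g -> continuous (fun x => dot (f x) (g x)).
Proof.
move=> cf cg; apply: continuous_big => [|i _ x]; first exact: add_continuous.
apply: continuousM.
  exact: (@continuous_comp _ _ _ f _ x (cf x) (@coord_continuous _ _ _ _ _ _)).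
exact: (@continuous_comp _ _ _ g _ x (cg x) (@coord_continuous _ _ _ _ _ _)).
Qed.

Lemma compact_dot_ball (R : realType) (n : nat) (r : R) :
  compact [set u : 'rV[R]_n | dot u u <= r].
Proof.
apply: (@subclosed_compact _ _
  [set v : 'rV[R]_n | forall i, `[- (r + 1), r + 1]%classic (v ord0 i)]).
- apply: (preimage_closed _ (@closed_le _ r)) => u _.
  by apply: continuous_dot => ?; exact: cvg_id.
- apply: (@rV_compact _ n (fun=> `[- (r + 1), r + 1]%classic)) => _.
  exact: segment_compact.
- move=> u /= ur i; have : u ord0 i ^+ 2 <= r.
    apply: le_trans ur; rewrite /dot (bigD1 i)//= -expr2 lerDl.
    by apply: sumr_ge0 => j _; rewrite -expr2 sqr_ge0.
  by rewrite in_itv/= => uir; apply/andP; split; nra.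
Qed.

(** The normal is [x - p], with [p] a nearest point to [x] among the convex combinations of [D].
    These form a compact subset of [C], so [C] itself may fail to be closed. *)
Lemma strict_separation (R : realType) (n : nat) (C D : set 'rV[R]_n)
    (x : 'rV[R]_n) :
  @convex_set R 'rV[R]_n C -> D `<=` C -> compact D -> D !=set0 -> ~ C x ->
  exists v, forall d, D d -> dot v d < dot v x.
Proof.
move=> cC DC cptD [d0 Dd0] Cx.
have cB : continuous (fun y : 'rV[R]_n => x - y).
  move=> y; apply: (@continuousB R 'rV[R]_n 'rV[R]_n (fun=> x) id).
    exact: cst_continuous.
  by move=> B.
have [p + pmin] := @compact_EVT_min _ R (fun y : 'rV[R]_n => dot (x - y) (x - y))
  (convex_comb n.+1 D) (ex_intro _ d0 (sub_convex_comb n Dd0))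
  (compact_convex_comb cptD) (continuous_subspaceT (continuous_dot cB cB)).
rewrite inE => Cp; exists (x - p) => d Dd.
have xp : 0 < dot (x - p) (x - p).
  apply: dot_gt0; rewrite subr_eq0; apply: contra_notN Cx => /eqP ->.
  exact: (convex_comb_sub cC DC Cp).
suff : dot (x - p) (d - p) <= 0 by move: xp; rewrite !dotE; lra.
rewrite leNgt; apply/negP => s0.
pose q := dot (d - p) (d - p).
have q0 : 0 <= q by exact: dot_ge0.
(* With [s = dot (x - p) (d - p)] assumed positive, this [t] lies in (0, 1] and satisfies
   [t * q <= s]. Moving from [p] towards [d] by [t] lowers the squared distance to [x] by
   [t * (2 * s - t * q) > 0], against the choice of [p]. *)
pose t := dot (x - p) (d - p) / (dot (x - p) (d - p) + q).
have t0 : 0 < t by rewrite divr_gt0// ltr_wpDr.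
have t1 : t <= 1 by rewrite ler_pdivrMr ?mul1r ?lerDl// ltr_wpDr.
have : convex_comb n.+1 D (t *: d + (1 - t) *: p).
  have /convex_setP := @convex_set_convex_comb R n D; apply => //.
    exact: sub_convex_comb.
  exact: ltW.
move=> /mem_set/pmin.
have -> : x - (t *: d + (1 - t) *: p) = (x - p) - t *: (d - p).
  by apply/rowP => i; rewrite !mxE; ring.
have sqE (u w : 'rV[R]_n) : dot (u - t *: w) (u - t *: w) =
    dot u u - t * (2 * dot u w - t * dot w w).
  by rewrite !dotE (dotC w u); ring.
rewrite sqE -/q lerBrDr gerDl pmulr_rle0// => h.
have : t * q <= dot (x - p) (d - p).
  by rewrite /t -mulrAC ler_pdivrMr ?ltr_wpDr// ler_pM2l// lerDr ltW.
by move: h s0; lra.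
Qed.

(** * Attainment of minima for lower semicontinuous functions *)

Lemma lsc_compact_min (T : topologicalType) (R : realType) (f : T -> \bar R)
    (K : set T) :
  lower_semicontinuous f -> compact K -> K !=set0 ->
  exists2 p, K p & forall y, K y -> (f p <= f y)%E.
Proof.
move=> flsc cK [x0 Kx0]; pose m := ereal_inf (f @` K).
have mle y : K y -> (m <= f y)%E by move=> Ky; apply: ereal_inf_lbound; exists y.
suff [p Kp fp] : exists2 p, K p & (f p <= m)%E.
  by exists p => // y /mle; exact: le_trans.
have [mfin|] := boolP (m < +oo)%E; last first.
  by rewrite -leNgt => moo; exists x0 => //; rewrite (le_trans (leey _)).
(* The sublevel sets in [K] at levels above the infimum generate a proper filter. By compactness it
   clusters at some [p], and lower semicontinuity forbids [f p] to exceed the infimum. *)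
pose F := filter_from [set a : R | (m < a%:E)%E]
  (fun a => K `&` [set x | (f x <= a%:E)%E]).
have FF : ProperFilter F.
  apply: filter_from_proper.
    apply: filter_from_filter.
      have [a ma _] : exists2 a : R, (m < a%:E)%E & (a%:E < +oo)%E.
        move: mfin; case: (m) => [r _| //|_].
          by exists (r + 1); rewrite ?ltry// lte_fin ltrDl.
        by exists 0; rewrite ?ltNyr ?ltry.
      by exists a.
    move=> a b ma mb; exists (Num.min a b).
      by rewrite /= /Num.min; case: ifP.
    move=> x [Kx fx]; split; split => //=; apply: le_trans fx _;
      by rewrite lee_fin ge_min lexx ?orbT.
  move=> a ma; have /ereal_inf_lt [_ [y Ky <-] ya] : (m < a%:E)%E by [].
  by exists y; split => //; exact: ltW.
have FK : F K.
  have [a ma _] : filter_from [set a : R | (m < a%:E)%E]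
      (fun a => K `&` [set x | (f x <= a%:E)%E]) setT by exact: filterT.
  by exists a => // x [].
have [p [Kp clp]] := cK F FF FK.
exists p => //; rewrite leNgt; apply/negP => mp.
have [a ma ap] : exists2 a : R, (m < a%:E)%E & (a%:E < f p)%E.
  move: mp mfin; case: (m) => [r||]//; case: (f p) => [s||]//; rewrite ?lte_fin.
  - move=> rs _; exists ((r + s) / 2); rewrite lte_fin; first by rewrite midf_lt.
    by rewrite midf_lt.
  - by move=> _ _; exists (r + 1); rewrite ?ltry// lte_fin ltrDl.
  - by move=> _ _; exists (s - 1); rewrite ?ltNyr// lte_fin gtrDl oppr_lt0.
  - by move=> _ _; exists 0; rewrite ?ltNyr ?ltry.
have [V Vp Vf] := flsc _ _ ap.
have Fa : F (K `&` [set x | (f x <= a%:E)%E]) by exists a.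
have [y [[_ /= fya] /Vf]] := clp _ _ Fa Vp.
by rewrite ltNge fya.
Qed.

Lemma argmin_coercive (R : realType) (n : nat) (F : 'rV[R]_n -> \bar R)
    (c C : R) :
  lower_semicontinuous F -> 0 < c ->
  (forall y, ((c * dot y y - C)%:E <= F y)%E) -> (exists x, (F x < +oo)%E) ->
  exists m : R, [/\ inf_fun F = m%:E, argmin F !=set0, compact (argmin F)
    & forall y, (m%:E <= F y)%E].
Proof.
move=> Flsc c0 Fge [x0 Fx0].
have [M FM] : exists M, F x0 = M%:E.
  have := Fge x0; move: Fx0; case: (F x0) => [r _ _|//|_].
    by exists r.
  by rewrite leeNy_eq.
(* By the quadratic lower bound, this ball contains every point where [F] is at most [F x0], so
   minimizing over it is enough. *)
pose K : set 'rV[R]_n := [set y | dot y y <= (M + C) / c].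
have FK y : (F y <= M%:E)%E -> K y.
  move=> FyM; have := le_trans (Fge y) FyM.
  by rewrite lee_fin lerBlDr mulrC -ler_pdivlMr.
have Kx0 : K x0 by apply: FK; rewrite FM.
have cK : compact K by exact: compact_dot_ball.
have [p Kp pminK] := lsc_compact_min Flsc cK (ex_intro _ x0 Kx0).
have pmin y : (F p <= F y)%E.
  have [/FK/pminK//|My] := leP (F y) M%:E.
  by apply: le_trans (ltW My); rewrite -FM; exact: pminK.
have infE : inf_fun F = F p.
  apply/eqP; rewrite eq_le; apply/andP; split.
    by apply: ereal_inf_lbound; exists p.
  by apply: le_ereal_inf_tmp => _ [y _ <-].
have [m Fp] : exists m, F p = m%:E.
  have := pmin x0; rewrite FM; have := Fge p.
  by case: (F p) => [r _ _|//|]; [exists r | rewrite leeNy_eq].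
exists m; split.
- by rewrite infE.
- by exists p; rewrite /argmin /= infE.
- apply: subclosed_compact (_ : closed _) cK _.
    rewrite (_ : argmin F = ~` [set y | (m%:E < F y)%E]).
      by apply: open_closedC; move/lower_semicontinuousP : Flsc; exact.
    apply/seteqP; split=> y; rewrite /argmin /= infE Fp.
      by move=> ->; rewrite ltxx.
    move/negP; rewrite -leNgt => ym; apply/eqP.
    by rewrite eq_le ym -Fp pmin.
  by move=> y; rewrite /argmin /= infE => Fy; apply: FK; rewrite Fy -FM.
- by move=> y; rewrite -Fp.
Qed.

(* The one-sided directional derivative of the conjugate of [F] at [0] is the
   support function of [argmin F]: by compactness a small tilt of [F] does not
   move its minimizers beyond a half-space containing [argmin F]. *)
Lemma tilted_lower_bound (R : realType) (n : nat) (F : 'rV[R]_n -> \bar R)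
    (c C m : R) (v : 'rV[R]_n) (h : R) :
  lower_semicontinuous F -> 0 < c ->
  (forall y, ((c * dot y y - C)%:E <= F y)%E) ->
  inf_fun F = m%:E -> (forall a, argmin F a -> dot v a < h) ->
  exists2 d : R, 0 < d &
    forall e, 0 < e -> e <= d -> forall y, ((m + e * (dot v y - h))%:E <= F y)%E.
Proof.
move=> Flsc c0 Fge Fm vh.
have mF y : (m%:E <= F y)%E by rewrite -Fm; apply: ereal_inf_lbound; exists y.
(* Chosen so that outside the ball [dot y y <= r] half of the quadratic growth pays for [B] and, by
   Young, the other half dominates [dot v y]. *)
pose B := C + m - h + (2 * c)^-1 * dot v v.
pose r := 2 * B / c.
have young y : dot v y <= c / 2 * dot y y + (2 * c)^-1 * dot v v.
  have := dot_young v y c0; rewrite invfM; lra.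
(* Where [dot v y <= h] the tilt is nonpositive and [m] suffices; outside the ball coercivity
   suffices, as [e <= 1]. Only the part of the ball with [h <= dot v y] is left. *)
suff [d d0 dP] : exists2 d : R, 0 < d <= 1 & forall y, h <= dot v y ->
    dot y y <= r -> ((m + d * (dot v y - h))%:E <= F y)%E.
  move/andP: d0 => [d0 d1]; exists d => // e e0 ed y.
  have [vy|vy] := leP (dot v y) h.
    by apply: le_trans (mF y); rewrite lee_fin; nra.
  have [yr|yr] := leP (dot y y) r.
    apply: le_trans (dP y (ltW vy) yr); rewrite lee_fin lerD2l ler_wpM2r//.
    by rewrite subr_ge0 ltW.
  apply: le_trans (Fge y); rewrite lee_fin.
  have : B <= c / 2 * dot y y.
    by move: yr; rewrite /r ltr_pdivrMr// => yr; lra.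
  have e1 : e <= 1 by exact: le_trans d1.
  have : e * (dot v y - h) <= dot v y - h by rewrite ler_piMl// subr_ge0 ltW.
  by have := young y; rewrite /B; lra.
pose K := [set y | dot y y <= r] `&` [set y | h <= dot v y].
have [K0|/set0P K0] := eqVneq K set0.
  exists 1; first by rewrite ltr01 lexx.
  by move=> y vy yr; have : K y by []; rewrite K0.
have cK : compact K.
  apply: compact_closedI; first exact: compact_dot_ball.
  apply: (preimage_closed _ (@closed_ge _ h)) => y _.
  by apply: continuous_dot; [exact: cst_continuous | move=> ?].
have [p [pr ph] pmin] := lsc_compact_min Flsc cK K0.
(* [K] is compact and misses [argmin F], hence [F] exceeds [m] on [K] by a uniform gap [s]. *)
have [s s0 sF] : exists2 s : R, 0 < s & ((m + s)%:E <= F p)%E.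
  have : (m%:E < F p)%E.
    rewrite lt_neqAle mF andbT; apply/eqP => mFp.
    have /vh : argmin F p by rewrite /argmin /= Fm.
    by rewrite ltNge ph.
  case: (F p) => [t||//].
    by rewrite lte_fin => mt; exists (t - m); rewrite ?subr_gt0// subrKC.
  by move=> _; exists 1; rewrite ?leey.
pose b := `|c / 2 * r + (2 * c)^-1 * dot v v - h| + 1.
have b0 : 0 < b by rewrite ltr_wpDl.
have hb y : dot y y <= r -> dot v y - h <= b.
  move=> yr; have := ler_norm (c / 2 * r + (2 * c)^-1 * dot v v - h).
  have : c / 2 * dot y y <= c / 2 * r by rewrite ler_wpM2l// divr_ge0// ltW.
  by have := young y; rewrite /b; lra.
(* On the ball [dot v y - h] is at most [b], so a tilt of size [s / b] stays within the gap [s]. *)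
exists (Num.min 1 (s / b)).
  by rewrite lt_min ltr01 divr_gt0//= ge_min lexx.
move=> y vy yr; apply: le_trans (pmin y _) => //; apply: le_trans sF.
rewrite lee_fin lerD2l.
apply: (@le_trans _ _ (s / b * (dot v y - h))).
  by rewrite ler_wpM2r ?subr_ge0// ge_min lexx orbT.
by rewrite mulrAC ler_pdivrMr// ler_pM2l// hb.
Qed.

(** * Quadratic perturbations, Moreau envelopes and conjugates *)

Lemma lower_semicontinuousD (T : topologicalType) (R : realType)
    (f : T -> \bar R) (q : T -> R) :
  lower_semicontinuous f -> continuous q ->
  lower_semicontinuous (fun x => f x + (q x)%:E)%E.
Proof.
move=> flsc cq x a; rewrite -lteBlDr// -EFinB => afx.
have [b ab bf] : exists2 b, a - q x < b & (b%:E < f x)%E.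
  move: afx; case: (f x) => [r||//].
    rewrite lte_fin => ar; exists ((a - q x + r) / 2); first by rewrite midf_lt.
    by rewrite lte_fin midf_lt.
  by move=> _; exists (a - q x + 1); rewrite ?ltry// ltrDl.
have [V Vx Vf] := flsc _ _ bf.
have Wx : nbhs x [set y | a - b < q y].
  by apply: (cvgr_gt (q x) (cq x)); rewrite ltrBlDl -ltrBlDr.
exists (V `&` [set y | a - b < q y]); first exact: filterI.
move=> y [/Vf bfy /= qy]; rewrite -lteBlDr// -EFinB.
by apply: lt_trans bfy; rewrite lte_fin ltrBlDl -ltrBlDr.
Qed.

Lemma lower_semicontinuous_add_quad (R : realType) (n : nat) (mu : R)
    (f : 'rV[R]_n -> \bar R) :
  lower_semicontinuous f -> lower_semicontinuous (add_quad mu f).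
Proof.
move=> flsc; apply: lower_semicontinuousD => //.
have -> : (fun x : 'rV[R]_n => (2 * mu)^-1 * enorm x ^+ 2) =
    (fun x => (2 * mu)^-1 * dot x x) by apply/funext => x; rewrite enorm_sqr.
move=> x; apply: (@continuousM R _ (fun=> (2 * mu)^-1) (fun x => dot x x)).
  exact: cst_continuous.
by apply: continuous_dot => ?.
Qed.

(** Some [lam > mu] has a finite lower bound for its envelope at a point [x0], which bounds [f]
    below by a quadratic of curvature [t = 1/(2 lam)]. Adding the curvature [s = 1/(2 mu) > t]
    leaves a positive margin. *)
Lemma add_quad_coercive (R : realType) (n : nat) (mu : R)
    (f : 'rV[R]_n -> \bar R) :
  0 < mu -> (mu%:E < prox_threshold f)%E ->
  exists c C : R, 0 < c /\
    forall y, ((c * dot y y - C)%:E <= add_quad mu f y)%E.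
Proof.
move=> mu0 /ereal_sup_gt[_ [lam [lam0 [x0 mx0]] <-]]; rewrite lte_fin => mulam.
have [C Cle] : exists C : R, (C%:E <= moreau lam f x0)%E.
  move: mx0; case: (moreau lam f x0) => [r _|_|//]; first by exists r.
  by exists 0; rewrite leey.
pose s := (2 * mu)^-1; pose t := (2 * lam)^-1.
have t0 : 0 < t by rewrite invr_gt0 mulr_gt0.
have ts : t < s by rewrite ltf_pV2 ?posrE ?mulr_gt0// ltr_pM2l.
(* Makes [t * e = (s - t) / 2]: Young's inequality spends half of the margin on the cross term with
   [x0]. *)
pose e := (s - t) / 2 / t.
have e0 : 0 < e by rewrite !divr_gt0// subr_gt0.
exists ((s - t) / 2), (t * (1 + e^-1) * dot x0 x0 - C).
split; first by rewrite divr_gt0// subr_gt0.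
move=> y; have := le_trans Cle
  (ereal_inf_lbound (ex_intro2 _ _ y I erefl)).
rewrite /add_quad !enorm_sqr -/s -/t.
case: (f y) => [r||]; last 2 first.
- by move=> _; rewrite addye// leey.
- by rewrite addNye leeNy_eq.
rewrite -!EFinD !lee_fin => h.
have := dot_young (- x0) y e0; rewrite !dotE => young.
have te : t * e = (s - t) / 2 by rewrite /e mulrC divfK// gt_eqF.
have : t * (2 * - dot x0 y) <=
    (s - t) / 2 * dot y y + t * e^-1 * dot x0 x0.
  rewrite -te -(mulrA t e) -(mulrA t e^-1) -mulrDr ler_pM2l//.
  by rewrite -[dot x0 x0]opprK.
by move: h; rewrite !dotE (dotC y x0); lra.
Qed.

(* [moreau mu f w = L w + |w|^2 / (2 mu)], where [L w] is minus the conjugate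
   of [f + |.|^2 / (2 mu)] at [w / mu]. *)
Lemma moreau_conjugate (R : realType) (n : nat) (mu : R)
    (f : 'rV[R]_n -> \bar R) (c C : R) (F := add_quad mu f) (s := (2 * mu)^-1) :
  0 < c -> (forall y, ((c * dot y y - C)%:E <= F y)%E) ->
  (exists x, (f x < +oo)%E) ->
  exists L : 'rV[R]_n -> R,
    [/\ forall w, moreau mu f w = (L w + s * dot w w)%:E,
        forall w y, ((L w + 2 * s * dot w y)%:E <= F y)%E
      & forall w l, (forall y, ((l + 2 * s * dot w y)%:E <= F y)%E) -> l <= L w].
Proof.
move=> c0 Fge [x0 fx0].
have termE w y : (f y + (s * enorm (y - w) ^+ 2)%:E =
    F y + (s * dot w w - 2 * s * dot w y)%:E)%E.
  rewrite /F /add_quad !enorm_sqr -/s -addeA -EFinD.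
  by congr (_ + _%:E)%E; rewrite !dotE (dotC y w); ring.
have lo w l : (forall y, ((l + 2 * s * dot w y)%:E <= F y)%E) ->
    ((l + s * dot w w)%:E <= moreau mu f w)%E.
  move=> lF; apply: le_ereal_inf_tmp => _ [y _ <-].
  rewrite termE -leeBlDr// -EFinB; apply: le_trans (lF y).
  by rewrite lee_fin; lra.
have up w y : (moreau mu f w <= F y + (s * dot w w - 2 * s * dot w y)%:E)%E.
  by rewrite -termE; apply: ereal_inf_lbound; exists y.
have fin w : moreau mu f w \is a fin_num.
  (* Young's inequality applied to [s *: w] and [y] shows that coercivity absorbs any linear tilt,
     so the envelope is above -oo; the point [x0] bounds it from above. *)
  have h y : ((- C - c^-1 * dot (s *: w) (s *: w) + 2 * s * dot w y)%:E
      <= F y)%E.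
    apply: le_trans (Fge y); rewrite lee_fin.
    by have := dot_young (s *: w) y c0; rewrite !dotE; lra.
  rewrite fin_numElt (lt_le_trans (ltNyr _) (lo _ _ h))/=.
  apply: le_lt_trans (up w x0) _.
  by rewrite /F /add_quad !lte_add_pinfty ?ltry.
exists (fun w => fine (moreau mu f w) - s * dot w w); split.
- by move=> w; rewrite subrK fineK.
- move=> w y; have := up w y; rewrite -{1}(fineK (fin w)) -leeBlDr// -EFinB.
  by apply: le_trans; rewrite lee_fin; lra.
- by move=> w l /lo; rewrite -{1}(fineK (fin w)) lee_fin; lra.
Qed.

(** Gathers what the theorem needs from each of its two functions: the value of [L] at 0, Fenchel's
    inequality on the hull of the minimizers, and a bound on the decrease of [L] along a ray from
    0. *)
Lemma moreau_argmin (R : realType) (n : nat) (mu : R)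
    (f : 'rV[R]_n -> \bar R) (F := add_quad mu f) (s := (2 * mu)^-1) :
  proper_fun f -> lower_semicontinuous f -> 0 < mu ->
  (mu%:E < prox_threshold f)%E ->
  exists (m : R) (L : 'rV[R]_n -> R),
    [/\ [/\ inf_fun F = m%:E, argmin F !=set0 & compact (argmin F)],
        forall w, moreau mu f w = (L w + s * dot w w)%:E, L 0 = m,
        forall a, conv_hull (argmin F) a -> forall w, L w + 2 * s * dot w a <= m
      & forall v h, (forall a, argmin F a -> dot v a < h) ->
          exists2 d : R, 0 < d & forall e, 0 < e -> e <= d ->
            m - e * h <= L ((e / (2 * s)) *: v)].
Proof.
move=> [fNy [x0 fx0]] flsc mu0 mulam.
have [c [C [c0 Fge]]] := add_quad_coercive mu0 mulam.
have Flsc := lower_semicontinuous_add_quad (mu := mu) flsc.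
have [L [mE Lup Llo]] := moreau_conjugate c0 Fge (ex_intro _ x0 fx0).
have Fx0 : exists x, (F x < +oo)%E.
  by exists x0; rewrite /F /add_quad lte_add_pinfty ?ltry.
have [m [Fm F0 cF mF]] := argmin_coercive Flsc c0 Fge Fx0.
have s0 : 0 < s by rewrite invr_gt0 mulr_gt0.
have up a : argmin F a -> forall w, L w + 2 * s * dot w a <= m.
  by move=> Fa w; have := Lup w a; rewrite -/F Fa Fm lee_fin.
exists m, L; split => //.
- apply/eqP; rewrite eq_le; apply/andP; split.
    have [a Fa] := F0; have := up a Fa 0.
    by rewrite dot0l mulr0 addr0.
  by apply: Llo => y; rewrite dot0l mulr0 addr0; exact: mF.
(* For fixed [w] the inequality cuts out a half-space in [a], so it passes from the minimizers to
   their hull. *)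
- move=> a ha w; suff : conv_hull (argmin F) `<=`
      [set a | L w + 2 * s * dot w a <= m] by apply.
  apply: smallest_sub => [|b /up]; last exact.
  apply/convex_setP => x y t /= hx hy t0 t1; rewrite !dotE.
  by nra.
- move=> v h vh.
  have [d d0 dP] := tilted_lower_bound Flsc c0 Fge Fm vh.
  (* The scaling [e / (2 * s)] turns [2 * s * dot w y] into the tilt [e * dot v y]. *)
  exists d => // e e0 ed; apply: Llo => y.
  rewrite dotZl mulrA [2 * s * _]mulrC divfK; last first.
    by rewrite gt_eqF// mulr_gt0.
  by apply: le_trans (dP e e0 ed y); rewrite lee_fin; lra.
Qed.

(** * Infimum and minimizers for the proximal average *)

Local Open Scope ereal_scope.

Theorem theorem7p6 (R : realType) (n : nat) (f g : 'rV[R]_n -> \bar R)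
    (mu alpha : R)
    (f_proper : proper_fun f) (g_proper : proper_fun g)
    (f_lsc : lower_semicontinuous f) (g_lsc : lower_semicontinuous g)
    (f_pb : prox_bounded f) (g_pb : prox_bounded g)
    (mu_gt0 : (0 < mu)%R)
    (mu_lt : mu%:E < Order.min (prox_threshold f) (prox_threshold g))
    (alpha_ge0 : (0 <= alpha)%R) (alpha_le1 : (alpha <= 1)%R) :
  inf_fun (add_quad mu (prox_avg mu alpha f g)) =
    alpha%:E * inf_fun (add_quad mu f) + (1 - alpha)%:E * inf_fun (add_quad mu g)
  /\
  argmin (add_quad mu (prox_avg mu alpha f g)) =
    minkowski_sum
      (scale_set alpha (conv_hull (argmin (add_quad mu f))))
      (scale_set (1 - alpha) (conv_hull (argmin (add_quad mu g))))
  /\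
  argmin (add_quad mu (prox_avg mu alpha f g)) !=set0.
Proof.
move: mu_lt; rewrite lt_min => /andP[mu_f mu_g].
have [mf [Lf [[-> [a0 Aa0] cA] mfE Lf0 Lfup Lflo]]] :=
  moreau_argmin f_proper f_lsc mu_gt0 mu_f.
have [mg [Lg [[-> [b0 Bb0] cB] mgE Lg0 Lgup Lglo]]] :=
  moreau_argmin g_proper g_lsc mu_gt0 mu_g.
rewrite -!EFinM -EFinD; set m := (_ + _)%R.
set A := argmin (add_quad mu f) in a0 Aa0 cA Lfup Lflo *.
set B := argmin (add_quad mu g) in b0 Bb0 cB Lgup Lglo *.
set Phi := add_quad mu (prox_avg mu alpha f g).
set M := minkowski_sum _ _.
pose s := ((2 * mu)^-1)%R.
have s0 : (0 < s)%R by rewrite invr_gt0 mulr_gt0.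
(* After the squares cancel, [Phi x] is the supremum over [w] of the left-hand side, that is, a
   conjugate at [x]. *)
have PhiP x (r : R) : Phi x <= r%:E <->
    forall w, (alpha * Lf w + (1 - alpha) * Lg w + 2 * s * dot w x <= r)%R.
  have -> : Phi x = - ereal_inf (range (fun w =>
      (- (alpha * Lf w + (1 - alpha) * Lg w + 2 * s * dot w x)
       + s * dot x x)%R%:E)) + (s * dot x x)%R%:E.
    rewrite /Phi /add_quad /prox_avg /moreau enorm_sqr -/s.
    congr (- ereal_inf _ + _); congr (_ @` _); apply/funext => w.
    rewrite -/(moreau mu f w) -/(moreau mu g w) mfE mgE enorm_sqr -/s.
    by congr _%:E; rewrite !dotE (dotC x w); ring.
  rewrite -leeBrDr// -EFinB leeNl -EFinN; split => [/ereal_infP h w|h].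
    have := h _ (ex_intro2 _ _ w I erefl); rewrite lee_fin; lra.
  by apply: le_ereal_inf_tmp => _ [w _ <-]; rewrite lee_fin; have := h w; lra.
(* Take [w = 0] in the supremum; the value -oo is excluded because it would lie below [m - 1]. *)
have mPhi x : m%:E <= Phi x.
  have Phi_lb r : Phi x <= r%:E -> (m <= r)%R.
    by move=> /PhiP/(_ 0%R); rewrite Lf0 Lg0 dot0l mulr0 addr0.
  case E: (Phi x) => [r||]; last 2 first.
  - by rewrite leey.
  - have := Phi_lb (m - 1)%R; rewrite E => /(_ (leNye _)).
    by rewrite lerBrDr gerDl ler10.
  - by rewrite lee_fin Phi_lb// E.
have sub_M x : M x -> Phi x <= m%:E.
  move=> [_ [a Aa <-] [_ [b Bb <-] <-]]; apply/PhiP => w; rewrite !dotE.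
  have := Lfup a Aa w; have := Lgup b Bb w; rewrite -/s /m => hb ha.
  have : (alpha * (Lf w + 2 * s * dot w a) <= alpha * mf)%R.
    by rewrite ler_wpM2l.
  have : ((1 - alpha) * (Lg w + 2 * s * dot w b) <= (1 - alpha) * mg)%R.
    by rewrite ler_wpM2l// subr_ge0.
  by lra.
have M0 : M (alpha *: a0 + (1 - alpha) *: b0)%R.
  exists (alpha *: a0)%R; first by exists a0 => //; exact: sub_conv_hull.
  exists ((1 - alpha) *: b0)%R => //.
  by exists b0 => //; exact: sub_conv_hull.
have infE : inf_fun Phi = m%:E.
  apply/eqP; rewrite eq_le; apply/andP; split.
    apply: ge_ereal_inf; eexists; last exact: sub_M M0.
    by eexists.
  by apply: le_ereal_inf_tmp => _ [x _ <-].
have argminE x : argmin Phi x <-> Phi x <= m%:E.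
  rewrite /argmin /= infE; split=> [->//|Phix].
  by apply/eqP; rewrite eq_le Phix mPhi.
have argminM : argmin Phi = M; last first.
  by split=> //; rewrite argminM; split=> //; eexists; exact: M0.
apply/seteqP; split=> x; rewrite argminE; last exact: sub_M.
move=> /PhiP Phix; apply: contrapT => Mx.
(* Separation is applied to the sum without hulls: it is compact because both argmin sets are, and
   it lies in the convex set [M]. *)
pose D := minkowski_sum (scale_set alpha A) (scale_set (1 - alpha) B).
have DM : D `<=` M.
  move=> _ [_ [a Aa <-] [_ [b Bb <-] <-]].
  exists (alpha *: a)%R; first by exists a => //; exact: sub_conv_hull.
  exists ((1 - alpha) *: b)%R => //.
  by exists b => //; exact: sub_conv_hull.
have cD : compact D.
  have -> : D = (fun p => (alpha *: p.1 + (1 - alpha) *: p.2)%R) @` (A `*` B).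
    apply/seteqP; split=> [_ [_ [a Aa <-] [_ [b Bb <-] <-]]|
      _ [[a b] [Aa Bb] <-]].
      by exists (a, b).
    exists (alpha *: a)%R; first by exists a.
    by exists ((1 - alpha) *: b)%R => //; exists b.
  apply: continuous_compact; last exact: compact_setX.
  apply: continuous_subspaceT => p.
  apply: (@continuousD R 'rV[R]_n _ (fun p => alpha *: p.1)%R
    (fun p => (1 - alpha) *: p.2)%R).
    apply: (@continuousZ R 'rV[R]_n _ (fun=> alpha) fst).
      exact: cst_continuous.
    exact: cvg_fst.
  apply: (@continuousZ R 'rV[R]_n _ (fun=> 1 - alpha)%R snd).
    exact: cst_continuous.
  exact: cvg_snd.
have D0 : D !=set0.
  exists (alpha *: a0 + (1 - alpha) *: b0)%R, (alpha *: a0)%R.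
    by exists a0.
  by exists ((1 - alpha) *: b0)%R => //; exists b0.
have [v vD] := strict_separation
  (convex_minkowski_sum_scale (@convex_conv_hull _ _ _)
    (@convex_conv_hull _ _ _)) DM cD D0 Mx.
have cv : continuous (fun y : 'rV[R]_n => dot v y).
  by apply: continuous_dot; [exact: cst_continuous | move=> ?].
(* [a] and [b] maximize [dot v] over [A] and [B], so the separation becomes one positive gap [e].
   Half of it supplies the strict bounds required by [Lflo] and [Lglo]. *)
have [a + amax] :=
  compact_EVT_max (ex_intro _ a0 Aa0) cA (continuous_subspaceT cv).
have [b + bmax] :=
  compact_EVT_max (ex_intro _ b0 Bb0) cB (continuous_subspaceT cv).
rewrite !inE => Bb Aa.
have : (dot v (alpha *: a + (1 - alpha) *: b) < dot v x)%R.
  apply: vD; exists (alpha *: a)%R; first by exists a.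
  by exists ((1 - alpha) *: b)%R => //; exists b.
rewrite !dotE -subr_gt0; set e := (_ - _)%R => e0.
have Av a' : A a' -> (dot v a' < dot v a + e / 2)%R.
  move=> Aa'; apply: (@le_lt_trans _ _ (dot v a)); last by rewrite ltrDl divr_gt0.
  by apply: amax; rewrite inE.
have Bv b' : B b' -> (dot v b' < dot v b + e / 2)%R.
  move=> Bb'; apply: (@le_lt_trans _ _ (dot v b)); last by rewrite ltrDl divr_gt0.
  by apply: bmax; rewrite inE.
have [d1 d10 Lfv] := Lflo v _ Av; have [d2 d20 Lgv] := Lglo v _ Bv.
pose d := Num.min d1 d2.
have d0 : (0 < d)%R by rewrite lt_min d10.
have dd1 : (d <= d1)%R by rewrite ge_min lexx.
have dd2 : (d <= d2)%R by rewrite ge_min lexx orbT.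
have fv := Lfv d d0 dd1; have gv := Lgv d d0 dd2.
(* At this [w] the weighted lower bounds give at least [m + d * e / 2], which exceeds the bound [m]
   from [Phix]. *)
have := Phix ((d / (2 * s)) *: v)%R.
rewrite dotZl mulrA [(2 * s * _)%R]mulrC divfK; last first.
  by rewrite gt_eqF// mulr_gt0.
have {}fv := ler_wpM2l alpha_ge0 fv.
have {}gv : ((1 - alpha) * (mg - d * (dot v b + e / 2)) <=
    (1 - alpha) * Lg ((d / (2 * s)) *: v))%R by rewrite ler_wpM2l// subr_ge0.
have de : (0 < d * e)%R by rewrite mulr_gt0.
move: de fv gv; rewrite /m /e; lra.
Qed.
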